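(* Let $H$ be an abelian Poisson algebra, and let $K$ be a commutative Poisson algebra. Let $\Gamma$ be an abstract kernel of $K$ to $H$. Then there is a natural bijective correspondence between the set $RExt_{\Gamma}(H,K)$ of equivalence classes of ring center extensions of $H$ by $K$ with the given abstract kernel $\Gamma$ and the second cohomology group $H^2_{\Gamma}(K,H)$.
   Context: All vector spaces are over a fixed field $\mathbb{F}$. A commutative Poisson algebra is a vector space $P$ with bilinear operations $\cdot$ and $[\ ,\ ]$ such that $(P,\cdot)$ is a commutative associative $\mathbb{F}$-algebra (no unit required), $(P,[\ ,\ ])$ is a Lie algebra (with $[x,x]=0$ and the Jacobi identity), and $[x\cdot y,z]=[x,z]\cdot y+x\cdot[y,z]$ for all $x,y,z\in P$. It is an abelian Poisson algebra if both operations are zero. Poisson algebra homomorphisms are linear maps preserving both operations. The ring center of $P$ is $Z_R(P)=\{x\in P: xy=0\ \text{for all } y\in P\}$. $Der(H)$ is the space of Poisson derivations of $H$ (linear maps that are derivations for both operations), regarded as a commutative Poisson algebra with the commutator bracket and zero product. $IDer(H)$ is the ideal of inner derivations $ad_a:k\mapsto[a,k]$, $a\in H$, and $OutDer(H)=Der(H)/IDer(H)$. An abstract kernel of $K$ to $H$ is a Poisson algebra homomorphism $K\to OutDer(H)$. When $H$ is abelian, $IDer(H)=0$, so an abstract kernel is a Poisson algebra homomorphism $\Gamma:K\to Der(H)$, written $x\mapsto\Gamma_x$. A ring center extension of $H$ by $K$ is a short exact sequence $\mathcal{E}\equiv 0\to H\xrightarrow{i}P\xrightarrow{\beta}K\to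 0$ of commutative Poisson algebras and Poisson algebra homomorphisms, where $H$ has trivial product and $i(H)\subseteq Z_R(P)$; $H$ is identified with $i(H)$. Two such extensions, with middle terms $P$ and $P'$, are equivalent if there is a Poisson algebra isomorphism $\phi:P\to P'$ inducing the identity on $H$ and on $K$. A section of $\mathcal{E}$ is a linear map $t:K\to P$ with $\beta\circ t=I_K$. The abstract kernel of $\mathcal{E}$ is the map $x\mapsto\Gamma^t_x+IDer(H)$, where $\Gamma^t_x(a)=[t(x),a]$ for $a\in H$; it does not depend on the choice of $t$. For $H$ abelian, $\mathcal{E}$ therefore has abstract kernel $\Gamma$ if $[t(x),a]=\Gamma_x(a)$ for all $x\in K$, $a\in H$. A $2$-cocycle of $K$ with coefficients in the abelian Poisson algebra $H$ (with abstract kernel $\Gamma$) is a triple $(f,h,\Gamma)$ with $f:K\times K\to H$ symmetric bilinear and $h:K\times K\to H$ alternating bilinear ($h(x,x)=0$), such that for all $x,y,z\in K$, $a\in H$: (1) $\Gamma_{xy}(a)=0$; (2) $f(xy,z)=f(x,yz)$; (3) $h([x,y],z)+h([y,z],x)+h([z,x],y)=\Gamma_z(h(x,y))+\Gamma_x(h(y,z))+\Gamma_y(h(z,x))$; (4) $h(xy,z)=\Gamma_z(f(x,y))+f([x,z],y)+f(x,[y,z])$. $Z^2_{\Gamma}(K,H)$ is the abelian group of these $2$-cocycles under $(f,h,\Gamma)+(f',h',\Gamma)=(f+f',h+h',\Gamma)$. $B^2_{\Gamma}(K,H)$ is the subgroup of those $2$-cocycles for which there is a linear map $g:K\to H$ with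 $f(x,y)=-g(xy)$ and $h(x,y)=\Gamma_x(g(y))-\Gamma_y(g(x))-g([x,y])$ for all $x,y\in K$. The second cohomology group of $K$ with coefficients in $H$ associated with $\Gamma$ is $H^2_{\Gamma}(K,H)=Z^2_{\Gamma}(K,H)/B^2_{\Gamma}(K,H)$. *)

(* Defs.v *)
From HB Require Import structures.
From mathcomp Require Import all_boot all_order all_algebra.
From mathcomp Require Import ring_quotient sesquilinear.
From mathcomp Require Import boolp classical_sets functions.

Set Implicit Arguments.
Unset Strict Implicit.
Unset Printing Implicit Defensive.

Import GRing.Theory.
Import Quotient.

Local Open Scope classical_set_scope.
Local Open Scope ring_scope.
Local Open Scope quotient_scope.

Reserved Notation "x ⋅ y" (at level 40, left associativity).
Reserved Notation "⟦ x , y ⟧" (at level 0, x, y at level 99).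
Reserved Notation "{ 'poisson' P -> Q }"
  (at level 0, P at level 98, Q at level 99, format "{ 'poisson'  P  ->  Q }").

HB.mixin Record Lmodule_isPoisson (F : fieldType) P of GRing.Lmodule F P := {
  pmul : P -> P -> P;
  pbracket : P -> P -> P;
  pmul_bilinear : bilinear_for *:%R *:%R pmul;
  pmulC : commutative pmul;
  pmulA : associative pmul;
  pbracket_bilinear : bilinear_for *:%R *:%R pbracket;
  pbracketxx : forall x, pbracket x x = 0;
  pbracket_jacobi : forall x y z,
    pbracket (pbracket x y) z + pbracket (pbracket y z) x
      + pbracket (pbracket z x) y = 0;
  pbracket_pmul : forall x y z,
    pbracket (pmul x y) z = pmul (pbracket x z) y + pmul x (pbracket y z)
}.

(* Commutative Poisson algebras; the associative product need not have a
   unit, so this does not build on the ring structures of ssralg *)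
#[short(type="poissonType")]
HB.structure Definition Poisson (F : fieldType) :=
  {P of GRing.Lmodule F P & Lmodule_isPoisson F P}.

Notation "x ⋅ y" := (pmul x y) : ring_scope.
Notation "⟦ x , y ⟧" := (pbracket x y) : ring_scope.

HB.mixin Record isPoissonMorphism (F : fieldType) (P Q : poissonType F)
    (f : P -> Q) := {
  poisson_morphM : forall x y, f (x ⋅ y) = f x ⋅ f y;
  poisson_morph_bracket : forall x y, f ⟦x, y⟧ = ⟦f x, f y⟧
}.

HB.structure Definition PoissonMorphism (F : fieldType)
    (P Q : poissonType F) :=
  {f of @GRing.Linear F P Q *:%R f & isPoissonMorphism F P Q f}.

Notation "{ 'poisson' P -> Q }" :=
  (PoissonMorphism.type P%type Q%type) : type_scope.

Definition abelian_poisson (F : fieldType) (P : poissonType F) : Prop :=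
  forall x y : P, x ⋅ y = 0 /\ ⟦x, y⟧ = 0.

Definition ring_center (F : fieldType) (P : poissonType F) : set P :=
  [set x | forall y, x ⋅ y = 0].

Section PoissonTheory.
Variables (F : fieldType) (P : poissonType F).
Implicit Types x y z : P.

Lemma pmulDl x y z : (x + y) ⋅ z = x ⋅ z + y ⋅ z.
Proof. by have := (@pmul_bilinear F P).1 z 1 x y; rewrite /= !scale1r. Qed.

Lemma pmulDr x y z : z ⋅ (x + y) = z ⋅ x + z ⋅ y.
Proof. by have := (@pmul_bilinear F P).2 z 1 x y; rewrite /= !scale1r. Qed.

Lemma pmul0l x : 0 ⋅ x = 0.
Proof. by apply: (addIr (0 ⋅ x)); rewrite -pmulDl !add0r. Qed.

Lemma pmul0r x : x ⋅ 0 = 0.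
Proof. by rewrite pmulC pmul0l. Qed.

Lemma pmulZl (a : F) x y : (a *: x) ⋅ y = a *: (x ⋅ y).
Proof.
by have := (@pmul_bilinear F P).1 y a x 0; rewrite /= !addr0 pmul0l addr0.
Qed.

Lemma pmulZr (a : F) x y : y ⋅ (a *: x) = a *: (y ⋅ x).
Proof. by rewrite pmulC pmulZl pmulC. Qed.

Lemma pmulNl x y : (- x) ⋅ y = - (x ⋅ y).
Proof. by rewrite -scaleN1r pmulZl scaleN1r. Qed.

Lemma pmulNr x y : y ⋅ (- x) = - (y ⋅ x).
Proof. by rewrite pmulC pmulNl pmulC. Qed.

Lemma pbracketDl x y z : ⟦x + y, z⟧ = ⟦x, z⟧ + ⟦y, z⟧.
Proof. by have := (@pbracket_bilinear F P).1 z 1 x y; rewrite /= !scale1r. Qed.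

Lemma pbracketDr x y z : ⟦z, x + y⟧ = ⟦z, x⟧ + ⟦z, y⟧.
Proof. by have := (@pbracket_bilinear F P).2 z 1 x y; rewrite /= !scale1r. Qed.

Lemma pbracket0l x : ⟦0, x⟧ = 0.
Proof. by apply: (addIr ⟦0, x⟧); rewrite -pbracketDl !add0r. Qed.

Lemma pbracket0r x : ⟦x, 0⟧ = 0.
Proof. by apply: (addIr ⟦x, 0⟧); rewrite -pbracketDr !add0r. Qed.

Lemma pbracketZl (a : F) x y : ⟦a *: x, y⟧ = a *: ⟦x, y⟧.
Proof.
by have := (@pbracket_bilinear F P).1 y a x 0;
  rewrite /= !addr0 pbracket0l addr0.
Qed.

Lemma pbracketZr (a : F) x y : ⟦y, a *: x⟧ = a *: ⟦y, x⟧.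
Proof.
by have := (@pbracket_bilinear F P).2 y a x 0;
  rewrite /= !addr0 pbracket0r addr0.
Qed.

Lemma pbracketNl x y : ⟦- x, y⟧ = - ⟦x, y⟧.
Proof. by rewrite -scaleN1r pbracketZl scaleN1r. Qed.

Lemma pbracketNr x y : ⟦y, - x⟧ = - ⟦y, x⟧.
Proof. by rewrite -scaleN1r pbracketZr scaleN1r. Qed.

End PoissonTheory.

Section Derivations.
Variables (F : fieldType) (H : poissonType F).

Definition derivation_axiom (d : H -> H) : Prop :=
  [/\ linear d,
      forall a b, d (a ⋅ b) = d a ⋅ b + a ⋅ d b
    & forall a b, d ⟦a, b⟧ = ⟦d a, b⟧ + ⟦a, d b⟧].

Definition is_derivation : {pred H -> H} :=
  fun d => `[< derivation_axiom d >].

Lemma derivationP (d : H -> H) :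
  reflect (derivation_axiom d) (d \in is_derivation).
Proof. exact: asboolP. Qed.

Lemma derivation_submod_closed : submod_closed is_derivation.
Proof.
have zE x : (0 : H -> H) x = 0 by [].
have lE (k : F) (d e : H -> H) x : (k *: d + e) x = k *: d x + e x by [].
split=> [|k d e /derivationP[dl dM dB] /derivationP[el eM eB]];
  apply/derivationP; split=> [a x y|x y|x y]; rewrite ?zE ?lE.
- by rewrite scaler0 addr0.
- by rewrite pmul0l pmul0r addr0.
- by rewrite pbracket0l pbracket0r addr0.
- by rewrite dl el !scalerDr !scalerA [k * a]mulrC addrACA.
- by rewrite dM eM pmulDl pmulDr pmulZl pmulZr scalerDr addrACA.
- by rewrite dB eB pbracketDl pbracketDr pbracketZl pbracketZr scalerDr addrACA.
Qed.

HB.instance Definition _ :=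
  GRing.isSubmodClosed.Build F (H -> H) is_derivation derivation_submod_closed.

Record der := Der { der_fun :> H -> H; der_funP : der_fun \in is_derivation }.

HB.instance Definition _ := [isSub of der for der_fun].
HB.instance Definition _ := [Choice of der by <:].
HB.instance Definition _ := [SubChoice_isSubLmodule of der by <:].

Implicit Types d e : der.

Lemma der_linear d : linear (d : H -> H).
Proof. by case/derivationP: (der_funP d). Qed.

HB.instance Definition _ d :=
  GRing.isLinear.Build F H H *:%R (d : H -> H) (der_linear d).

Lemma derM d x y : d (x ⋅ y) = d x ⋅ y + x ⋅ d y.
Proof. by case/derivationP: (der_funP d). Qed.

Lemma der_bracket d x y : d ⟦x, y⟧ = ⟦d x, y⟧ + ⟦x, d y⟧.
Proof. by case/derivationP: (der_funP d). Qed.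

Lemma der_ext d e : (forall x, d x = e x) -> d = e.
Proof. by move=> de; apply/val_inj/funext. Qed.

Lemma commutator_derivation d e :
  (fun x => d (e x) - e (d x)) \in is_derivation.
Proof.
have aux (a a' b c f f' : H) :
    a + b + (c + f) + (- (a' + c) - (b + f')) = a - a' + (f - f').
  by rewrite [a + b + _]addrACA [LHS]addrACA (addrC a') addrKA (addrC b f) addrKA.
apply/derivationP; split=> [a x y|x y|x y].
- by rewrite !linearP /= addrACA -scalerDr.
- by rewrite !derM !raddfD /= !derM pmulDl pmulDr pmulNl pmulNr; exact: aux.
- rewrite !der_bracket !raddfD /= !der_bracket.
  by rewrite pbracketDl pbracketDr pbracketNl pbracketNr; exact: aux.
Qed.

Definition commutator d e := Der (commutator_derivation d e).

Lemma der_pmul_bilinear :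
  bilinear_for *:%R *:%R (fun _ _ : der => 0 : der).
Proof. by split=> d a e e'; rewrite /= scaler0 addr0. Qed.

Lemma commutator_bilinear : bilinear_for *:%R *:%R commutator.
Proof.
split=> d a e e'; apply: der_ext => x.
- change (a *: e (d x) + e' (d x) - d (a *: e x + e' x)
    = a *: (e (d x) - d (e x)) + (e' (d x) - d (e' x))).
  by rewrite linearP opprD addrACA -scalerBr.
- change (d (a *: e x + e' x) - (a *: e (d x) + e' (d x))
    = a *: (d (e x) - e (d x)) + (d (e' x) - e' (d x))).
  by rewrite linearP opprD addrACA -scalerBr.
Qed.

Lemma commutatorxx d : commutator d d = 0.
Proof. by apply: der_ext => x /=; rewrite subrr. Qed.

Lemma commutator_jacobi d1 d2 d3 :
  commutator (commutator d1 d2) d3 + commutator (commutator d2 d3) d1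
    + commutator (commutator d3 d1) d2 = 0.
Proof.
have aux (a b c d e f : H) : a - b - (c - d) + (e - d - (a - f))
    + (c - f - (e - b)) = 0.
  rewrite !opprB [LHS](AC ((2*2)*(2*2)*(2*2))
    ((1*8)*(2*11)*(3*6)*(4*9)*(5*12)*(7*10))).
  by rewrite /= !addrN !addNr !addr0.
apply: der_ext => x.
change (commutator (commutator d1 d2) d3 x
  + commutator (commutator d2 d3) d1 x
  + commutator (commutator d3 d1) d2 x = 0).
have dB d u v : d (u - v) = d u - d v by rewrite raddfB.
by rewrite /= !dB; exact: aux.
Qed.

Lemma commutator0l d : commutator (0 : der) d = 0 + 0 :> der.
Proof. by apply: der_ext => x /=; rewrite raddf0 subrr addr0. Qed.

(* The Poisson algebra Der(H): zero product and commutator bracket *)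
HB.instance Definition _ := Lmodule_isPoisson.Build F der
  der_pmul_bilinear (fun _ _ => erefl) (fun _ _ _ => erefl)
  commutator_bilinear commutatorxx commutator_jacobi
  (fun _ _ => commutator0l).

End Derivations.

Section Cohomology.
Variables (F : fieldType) (H K : poissonType F).

(* An abstract kernel of K to H is a morphism from K to Der(H)/IDer(H).  For
   abelian H, the only case in which these definitions are used, IDer(H) = 0
   and it is a morphism from K to Der(H) *)
Variable Γ : {poisson K -> der H}.

Record cocycle_axiom (f h : K -> K -> H) : Prop := CocycleAxiom {
  cocycle_f_bilinear : bilinear_for *:%R *:%R f;
  cocycle_f_sym : forall x y, f x y = f y x;
  cocycle_h_bilinear : bilinear_for *:%R *:%R h;
  cocycle_h_alt : forall x, h x x = 0;
  cocycle1 : forall x y a, Γ (x ⋅ y) a = 0;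
  cocycle2 : forall x y z, f (x ⋅ y) z = f x (y ⋅ z);
  cocycle3 : forall x y z,
    h ⟦x, y⟧ z + h ⟦y, z⟧ x + h ⟦z, x⟧ y
    = Γ z (h x y) + Γ x (h y z) + Γ y (h z x);
  cocycle4 : forall x y z,
    h (x ⋅ y) z = Γ z (f x y) + f ⟦x, z⟧ y + f x ⟦y, z⟧
}.

(* Γ is a parameter of all that follows, so the cocycle (f, h, Γ) is
   represented by the pair (f, h) *)
Definition is_cocycle : {pred (K -> K -> H) * (K -> K -> H)} :=
  fun c => `[< cocycle_axiom c.1 c.2 >].

Lemma is_cocycleP c : reflect (cocycle_axiom c.1 c.2) (c \in is_cocycle).
Proof. exact: asboolP. Qed.

Lemma cocycle_zmod_closed : zmod_closed is_cocycle.
Proof.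
have Γ0 x y a : Γ (x ⋅ y) a = 0 by rewrite poisson_morphM.
have sub1 (c c' : (K -> K -> H) * (K -> K -> H)) x y :
  (c - c').1 x y = c.1 x y - c'.1 x y by [].
have sub2 (c c' : (K -> K -> H) * (K -> K -> H)) x y :
  (c - c').2 x y = c.2 x y - c'.2 x y by [].
have sub3 (a b c a' b' c' : H) :
    a - a' + (b - b') + (c - c') = a + b + c - (a' + b' + c').
  by rewrite !opprD [a - a' + _]addrACA [LHS]addrACA.
split=> [|c c' /is_cocycleP[fb fs hb ha _ c2 c3 c4]
              /is_cocycleP[fb' fs' hb' ha' _ c2' c3' c4']];
  apply/is_cocycleP.
  split=> [|//||//|//|//|x y z|x y z].
  - by split=> u a v w; rewrite /= scaler0 addr0.
  - by split=> u a v w; rewrite /= scaler0 addr0.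
  - by rewrite /= !linear0 !addr0.
  - by rewrite /= linear0 !addr0.
split=> [|x y||x|//|x y z|x y z|x y z]; rewrite ?(sub1, sub2).
- split=> u a v w.
  + change (c.1 (a *: v + w) u - c'.1 (a *: v + w) u
      = a *: (c.1 v u - c'.1 v u) + (c.1 w u - c'.1 w u)).
    by rewrite (fb.1 u a v w) (fb'.1 u a v w) /= opprD addrACA -scalerBr.
  + change (c.1 u (a *: v + w) - c'.1 u (a *: v + w)
      = a *: (c.1 u v - c'.1 u v) + (c.1 u w - c'.1 u w)).
    by rewrite (fb.2 u a v w) (fb'.2 u a v w) /= opprD addrACA -scalerBr.
- by rewrite fs fs'.
- split=> u a v w.
  + change (c.2 (a *: v + w) u - c'.2 (a *: v + w) u
      = a *: (c.2 v u - c'.2 v u) + (c.2 w u - c'.2 w u)).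
    by rewrite (hb.1 u a v w) (hb'.1 u a v w) /= opprD addrACA -scalerBr.
  + change (c.2 u (a *: v + w) - c'.2 u (a *: v + w)
      = a *: (c.2 u v - c'.2 u v) + (c.2 u w - c'.2 u w)).
    by rewrite (hb.2 u a v w) (hb'.2 u a v w) /= opprD addrACA -scalerBr.
- by rewrite ha ha' subrr.
- by rewrite c2 c2'.
- by rewrite sub3 c3 c3' !raddfB /= sub3.
- by rewrite c4 c4' raddfB /= sub3.
Qed.

HB.instance Definition _ :=
  GRing.isZmodClosed.Build ((K -> K -> H) * (K -> K -> H))%type is_cocycle
    cocycle_zmod_closed.

Record Z2 := Cocycle {
  cocycle_val :> (K -> K -> H) * (K -> K -> H);
  cocycle_valP : cocycle_val \in is_cocycle
}.

HB.instance Definition _ := [isSub of Z2 for cocycle_val].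
HB.instance Definition _ := [Choice of Z2 by <:].
HB.instance Definition _ := [SubChoice_isSubZmodule of Z2 by <:].

Definition coboundary_axiom (c : Z2) : Prop :=
  exists g : {linear K -> H}, forall x y,
    c.1 x y = - g (x ⋅ y) /\ c.2 x y = Γ x (g y) - Γ y (g x) - g ⟦x, y⟧.

Definition B2 : {pred Z2} := fun c => `[< coboundary_axiom c >].

Lemma B2P c : reflect (coboundary_axiom c) (c \in B2).
Proof. exact: asboolP. Qed.

Lemma B2_zmod_closed : zmod_closed B2.
Proof.
have aux (a b e a' b' e' : H) :
    a - b - e - (a' - b' - e') = a - a' - (b - b') - (e - e').
  by rewrite opprD [LHS]addrACA opprD [a - b + _]addrACA -!opprD.
have ΓB x u v : Γ x (u - v) = Γ x u - Γ x v by rewrite raddfB.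
split=> [|c c' /B2P[g cg] /B2P[g' cg']]; apply/B2P.
  exists (\0 : {linear K -> H}) => x y.
  change (0 = - 0 :> H /\ 0 = Γ x 0 - Γ y 0 - 0 :> H).
  by rewrite !linear0 !addr0.
exists (g \- g' : {linear K -> H}) => x y.
have [cf ch] := cg x y; have [cf' ch'] := cg' x y; split.
- by change (c.1 x y - c'.1 x y = - (g (x ⋅ y) - g' (x ⋅ y)));
    rewrite cf cf' opprD.
- change (c.2 x y - c'.2 x y = Γ x (g y - g' y) - Γ y (g x - g' x)
    - (g ⟦x, y⟧ - g' ⟦x, y⟧)).
  by rewrite ch ch' !ΓB aux.
Qed.

HB.instance Definition _ := GRing.isZmodClosed.Build Z2 B2 B2_zmod_closed.

Definition H2 := {quot B2}.
HB.instance Definition _ := EqQuotient.on H2.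
HB.instance Definition _ := GRing.Zmodule.on H2.
HB.instance Definition _ := ZmodQuotient.on H2.

End Cohomology.

Section RingCenterExtensions.
Variables (F : fieldType) (H K : poissonType F).

Record rcExtension := RcExtension {
  ext_alg :> poissonType F;
  ext_in : {poisson H -> ext_alg};
  ext_out : {poisson ext_alg -> K};
  ext_in_inj : injective ext_in;
  ext_out_surj : range ext_out = setT;
  ext_exact : range ext_in = ext_out @^-1` [set 0];
  ext_pmul0 : forall a b : H, a ⋅ b = 0;
  ext_central : range ext_in `<=` @ring_center F ext_alg
}.

Definition ext_equiv (E E' : rcExtension) : Prop :=
  exists φ : {poisson E -> E'},
    [/\ bijective φ,
        forall a, φ (ext_in E a) = ext_in E' a
      & forall p, ext_out E' (φ p) = ext_out E p].

Definition is_section (E : rcExtension) (t : {linear K -> E}) : Prop :=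
  cancel t (ext_out E).

(* Linear sections always exist, since a surjection of vector spaces splits *)
Definition has_abstract_kernel (Γ : {poisson K -> der H}) (E : rcExtension) :
    Prop :=
  forall t : {linear K -> E}, is_section t ->
  forall x a, ⟦t x, ext_in E a⟧ = ext_in E (Γ x a).

Record RExt (Γ : {poisson K -> der H}) := ExtClass {
  ext_class_set :> set rcExtension;
  ext_class_setP : exists2 E, has_abstract_kernel Γ E
                            & ext_class_set = [set E' | ext_equiv E E']
}.

Definition ext_class (Γ : {poisson K -> der H}) (E : rcExtension)
    (EΓ : has_abstract_kernel Γ E) : RExt Γ :=
  ExtClass (ex_intro2 _ _ E EΓ erefl).

Definition cocycle_of_section (Γ : {poisson K -> der H}) (E : rcExtension)
    (t : {linear K -> E}) (c : Z2 Γ) : Prop :=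
  forall x y, ext_in E (c.1 x y) = t x ⋅ t y - t (x ⋅ y)
           /\ ext_in E (c.2 x y) = ⟦t x, t y⟧ - t ⟦x, y⟧.

End RingCenterExtensions.

(* Main.v *)
Require Import Defs.
From HB Require Import structures.
From mathcomp Require Import all_boot all_algebra ring_quotient.
From mathcomp Require Import boolp classical_sets.

Set Implicit Arguments.
Unset Strict Implicit.
Unset Printing Implicit Defensive.

Import GRing.Theory.

Local Open Scope ring_scope.
Local Open Scope quotient_scope.

(** A linear section t of an extension E writes every element of E uniquely as
    a + t x with a in H and x in K.  Since H annihilates E for the product and
    has zero bracket, both operations of E can be read off in these
    coordinates from the action of K on H and from the two defects
    f(x,y) = t x ⋅ t y - t (x ⋅ y) and h(x,y) = [t x, t y] - t [x, y]:
      (a + t x) ⋅ (b + t y) = f(x,y) + t (x ⋅ y),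
      [a + t x, b + t y] = Γ_x b - Γ_y a + h(x,y) + t [x, y]
    (ext_pmulE, ext_bracketE).  The axioms of a Poisson algebra for E then say
    that (f, h) is a cocycle (section_cocycle), and conversely any cocycle
    turns H * K into an extension by the same formulas (cocycle_realized).

    Everything is organised around the relation realizes E c: some section of E
    acts on H through Γ and has defect c.  Three facts carry the proof.
    - If E realizes c, the extensions that realize c are exactly those
      equivalent to E (realizes_equiv, equiv_realizes).  Thus an equivalence
      class is the set of extensions realizing one cocycle.
    - Replacing t by t + g, with g : K -> H linear, adds to the defect the
      coboundary of g.  Hence if E realizes c, it realizes every cocycle
      cohomologous to c (realizes_cohomologous).
    - Two sections differ by such a g, so two cocycles realized by the same E
      are cohomologous (realizes_sub).
    The correspondence sends a class to the cohomology class of any cocycle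
    realized by its members; that some section exists at all is an application
    of Zorn's lemma (linear_section). *)

(** * Splitting surjective linear maps *)

Section LinearSections.
Variables (F : fieldType) (V W : lmodType F).

Lemma linear_of_fun (g : W -> V) :
  linear g -> exists t : {linear W -> V}, forall x, t x = g x.
Proof.
move=> gl; pose m := GRing.isLinear.Build F W V *:%R g gl.
by pose t : {linear W -> V} := HB.pack g m; exists t.
Qed.

(** Apart from the fact that A may be empty, A is a subspace meeting the kernel
    of f trivially.  Allowing the empty set makes the union of the empty chain
    transverse, so that every chain is covered by the same argument. *)
Definition transverse (f : V -> W) (A : set V) : Prop :=
  (forall a u v, A u -> A v -> A (a *: u + v)) /\
  (forall u, A u -> f u = 0 -> u = 0).

Lemma maximal_transverse (f : {linear V -> W}) : exists A : set V,
  transverse f A /\ forall B, (A `<` B)%classic -> ~ transverse f B.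
Proof.
apply: Zorn_bigcup => C CP Ctot; split=> [a u v [X CX Xu] [Y CY Yv]|u [X CX Xu]].
  case: (Ctot X Y CX CY) => sXY.
  - by exists Y => //; apply: (CP Y CY).1 => //; apply: sXY.
  - by exists X => //; apply: (CP X CX).1 => //; apply: sXY.
exact: (CP X CX).2.
Qed.

(** A maximal subspace A transverse to the kernel of f is mapped bijectively
    onto W: if y = f p were not in f(A), the span of A and p would still be
    transverse.  The section is the inverse of f on A. *)
Lemma linear_section (f : {linear V -> W}) :
  range f = setT -> exists t : {linear W -> V}, cancel t f.
Proof.
move=> fsurj; have [A [[Alin Aker] Amax]] := maximal_transverse f.
have A0 : A 0.
  apply: contrapT => nA0; apply: (Amax (A `|` [set 0])%classic).
    by split=> [u Au|/(_ 0 (or_intror erefl))//]; left.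
  have AE u : ~ A u.
    by move=> Au; apply: nA0; rewrite -(addNr u) -scaleN1r; apply: Alin.
  split=> [a u v [/AE//|->] [/AE//|->]|u [/AE//|->//]].
  by rewrite scaler0 addr0; right.
have AZ a u : A u -> A (a *: u) by move=> Au; rewrite -[_ *: _]addr0; apply: Alin.
have fA y : exists2 u, A u & f u = y.
  have [p _ fp] : range f y by rewrite fsurj.
  apply: contrapT => nfA.
  pose B := [set v | exists c u, A u /\ v = c *: p + u]%classic.
  apply: (Amax B); split.
  - by move=> u Au; exists 0, u; rewrite scale0r add0r.
  - move=> BA; apply: nfA; exists p => //; apply: BA.
    by exists 1, 0; rewrite scale1r addr0.
  - move=> a _ _ [c [u [Au ->]]] [d [v [Av ->]]].
    exists (a * c + d), (a *: u + v); split; first exact: Alin.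
    by rewrite scalerDr scalerDl scalerA addrACA.
  (* if c p + u is killed by f and c != 0, then - c^-1 u is a preimage of y *)
  - move=> _ [c [u [Au ->]]] fcpu.
    have [c0|c0] := eqVneq c 0.
      by move: fcpu; rewrite c0 scale0r add0r; exact: Aker.
    case: nfA; exists (- c^-1 *: u); first exact: AZ.
    apply: (scalerI c0); rewrite linearZ /= scalerA mulrN divff // scaleN1r.
    by apply/eqP; rewrite eq_sym -addr_eq0 -fp -linearZ -linearD fcpu.
have fA2 y : exists u, A u /\ f u = y by have [u] := fA y; exists u.
have [g gP] := choice fA2.
have g_lin : linear g.
  move=> a x y; apply/esym/eqP; rewrite -subr_eq0; apply/eqP.
  have [Ax fx] := gP x; have [Ay fy] := gP y; have [As fs] := gP (a *: x + y).
  rewrite [LHS]addrC -scaleN1r; apply: Aker.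
    by do 2?[apply: (Alin) => //].
  by rewrite !linearP /= fs fx fy scaleN1r addNr.
have [t tE] := linear_of_fun g_lin.
by exists t => y; rewrite tE; have [] := gP y.
Qed.

End LinearSections.

(** * Poisson algebras, morphisms and abstract kernels *)

Section PoissonBracket.
Variables (F : fieldType) (P : poissonType F).

Lemma pbracketC (x y : P) : ⟦x, y⟧ = - ⟦y, x⟧.
Proof.
apply/eqP; rewrite -addr_eq0; apply/eqP.
by have := pbracketxx (x + y); rewrite pbracketDl !pbracketDr !pbracketxx add0r addr0.
Qed.

End PoissonBracket.

Lemma poisson_of_fun (F : fieldType) (P Q : poissonType F) (g : P -> Q) :
    linear g -> (forall x y, g (x ⋅ y) = g x ⋅ g y) ->
    (forall x y, g ⟦x, y⟧ = ⟦g x, g y⟧) ->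
  exists φ : {poisson P -> Q}, forall x, φ x = g x.
Proof.
move=> gl gM gB; pose m := GRing.isLinear.Build F P Q *:%R g gl.
pose n := isPoissonMorphism.Build F P Q g gM gB.
by pose t : {poisson P -> Q} := HB.pack g m n; exists t.
Qed.

Section AbstractKernel.
Variables (F : fieldType) (H K : poissonType F) (Γ : {poisson K -> der H}).

Lemma kernel_linear a x y u : Γ (a *: x + y) u = a *: Γ x u + Γ y u.
Proof. by rewrite linearP. Qed.

Lemma kernel0 u : Γ 0 u = 0.
Proof. by rewrite linear0. Qed.

(** The product of Der(H) is zero. *)
Lemma kernelM x y u : Γ (x ⋅ y) u = 0.
Proof. by rewrite poisson_morphM. Qed.

Lemma kernel_bracket x y u : Γ ⟦x, y⟧ u = Γ x (Γ y u) - Γ y (Γ x u).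
Proof. by rewrite poisson_morph_bracket. Qed.

End AbstractKernel.

(** * Extensions in the coordinates given by a section *)

Section Extension.
Variables (F : fieldType) (H K : poissonType F) (E : rcExtension H K).

Lemma ext_out_in a : ext_out E (ext_in E a) = 0.
Proof.
have : (ext_out E @^-1` [set 0])%classic (ext_in E a).
  by rewrite -ext_exact; exists a.
by [].
Qed.

Lemma ext_out_eq0 p : ext_out E p = 0 -> exists a, ext_in E a = p.
Proof.
move=> p0; have [a _ <-] : range (ext_in E) p by rewrite ext_exact.
by exists a.
Qed.

Lemma ext_in_pmul a p : ext_in E a ⋅ p = 0.
Proof. by apply: (@ext_central _ _ _ E); exists a. Qed.

Lemma ext_section_exists : exists t : {linear K -> E}, is_section t.
Proof. exact/linear_section/ext_out_surj. Qed.

Lemma ext_coord (t : {linear K -> E}) : is_section t -> exists r : {linear E -> H},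
  forall p, ext_in E (r p) = p - t (ext_out E p).
Proof.
move=> tK.
have /choice[g gP] p : exists a, ext_in E a = p - t (ext_out E p).
  by apply: ext_out_eq0; rewrite linearB /= tK subrr.
have g_lin : linear g.
  move=> a p q; apply: (@ext_in_inj _ _ _ E).
  by rewrite linearP /= !gP (linearP (ext_out E)) (linearP t) /= scalerBr opprD addrACA.
have [r rE] := linear_of_fun g_lin.
by exists r => p; rewrite rE.
Qed.

(** The condition on a single section t which, by acts_by_kernel, is enough for
    the extension to have abstract kernel Γ. *)
Definition acts_by (Γ : {poisson K -> der H}) (t : {linear K -> E}) : Prop :=
  forall x a, ⟦t x, ext_in E a⟧ = ext_in E (Γ x a).

Definition realizes (Γ : {poisson K -> der H}) (c : Z2 Γ) : Prop :=
  exists t : {linear K -> E},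
    [/\ is_section t, cocycle_of_section t c & acts_by Γ t].

Lemma ext_decompose (t : {linear K -> E}) : is_section t ->
  forall p, exists a x, p = ext_in E a + t x.
Proof.
move=> tK p; have [r rE] := ext_coord tK.
by exists (r p), (ext_out E p); rewrite rE subrK.
Qed.

End Extension.

Section AbelianBase.
Variables (F : fieldType) (H K : poissonType F) (abH : abelian_poisson H).
Variable Γ : {poisson K -> der H}.

Lemma ext_in_bracket (E : rcExtension H K) a b :
  ⟦ext_in E a, ext_in E b⟧ = 0.
Proof. by rewrite -poisson_morph_bracket (abH a b).2 linear0. Qed.

(** Two sections differ by elements of H, which bracket trivially with H. *)
Lemma acts_by_kernel (E : rcExtension H K) (t : {linear K -> E}) :
  is_section t -> acts_by Γ t -> has_abstract_kernel Γ E.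
Proof.
move=> tK tΓ t' t'K x a.
have [b bE] : exists b, ext_in E b = t' x - t x.
  by apply: ext_out_eq0; rewrite linearB /= tK t'K subrr.
by rewrite -[t' x](subrK (t x)) -bE pbracketDl ext_in_bracket add0r tΓ.
Qed.

Section Multiplication.
Variables (E : rcExtension H K) (t : {linear K -> E}) (c : Z2 Γ).
Hypotheses (tc : cocycle_of_section t c) (tΓ : acts_by Γ t).

Lemma ext_pmulE a b x y :
  (ext_in E a + t x) ⋅ (ext_in E b + t y)
  = ext_in E (c.1 x y) + t (x ⋅ y).
Proof.
rewrite pmulDl !pmulDr !ext_in_pmul [t x ⋅ ext_in E b]pmulC ext_in_pmul.
by rewrite !add0r (tc x y).1 subrK.
Qed.

Lemma ext_bracketE a b x y :
  ⟦ext_in E a + t x, ext_in E b + t y⟧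
  = ext_in E (Γ x b - Γ y a + c.2 x y) + t ⟦x, y⟧.
Proof.
rewrite pbracketDl !pbracketDr ext_in_bracket [⟦ext_in E a, _⟧]pbracketC !tΓ.
by rewrite add0r linearD linearB /= (tc x y).2 -addrA subrK addrA [- _ + _]addrC.
Qed.

End Multiplication.

(** The short five lemma. *)
Lemma ext_morphism_bijective (E E' : rcExtension H K) (φ : {poisson E -> E'}) :
  (forall a, φ (ext_in E a) = ext_in E' a) ->
  (forall p, ext_out E' (φ p) = ext_out E p) -> bijective φ.
Proof.
move=> φin φout.
have φ_ker p : φ p = 0 -> p = 0.
  move=> p0; have [|a aE] := @ext_out_eq0 _ _ _ E p; first by rewrite -φout p0 linear0.
  by move: p0; rewrite -aE φin -(linear0 (ext_in E')) => /ext_in_inj ->; rewrite linear0.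
have [t tK] := ext_section_exists E.
have /choice[ψ ψK] q : exists p, φ p = q.
  have [|a aE] := @ext_out_eq0 _ _ _ E' (q - φ (t (ext_out E' q))).
    by rewrite linearB /= φout tK subrr.
  by exists (ext_in E a + t (ext_out E' q)); rewrite linearD /= φin aE subrK.
exists ψ => // p; apply/eqP; rewrite -subr_eq0; apply/eqP/φ_ker.
by rewrite linearB /= ψK subrr.
Qed.

(** In coordinates the operations depend only on Γ and the cocycle, so the
    linear map a + t x |-> a + t' x is a morphism. *)
Lemma realizes_equiv (E E' : rcExtension H K) (c : Z2 Γ) :
  realizes E c -> realizes E' c -> ext_equiv E E'.
Proof.
move=> [t [tK tc tΓ]] [t' [t'K t'c t'Γ]].
have [r rE] := ext_coord tK.
pose j a x := ext_in E a + t x.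
pose φ p := ext_in E' (r p) + t' (ext_out E p).
have φj a x : φ (j a x) = ext_in E' a + t' x.
  have out_j : ext_out E (j a x) = x by rewrite linearD /= ext_out_in tK add0r.
  have r_j : r (j a x) = a.
    by apply: (@ext_in_inj _ _ _ E); rewrite rE out_j addrK.
  by rewrite /φ out_j r_j.
have φ_lin : linear φ.
  by move=> a p q; rewrite /φ !linearP /= scalerDr addrACA.
have φM p q : φ (p ⋅ q) = φ p ⋅ φ q.
  have [a [x ->]] := ext_decompose tK p; have [b [y ->]] := ext_decompose tK q.
  by rewrite (ext_pmulE tc) !φj (ext_pmulE t'c).
have φB p q : φ ⟦p, q⟧ = ⟦φ p, φ q⟧.
  have [a [x ->]] := ext_decompose tK p; have [b [y ->]] := ext_decompose tK q.
  by rewrite (ext_bracketE tc tΓ) !φj (ext_bracketE t'c t'Γ).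
have [ψ ψE] := poisson_of_fun φ_lin φM φB.
have ψin a : ψ (ext_in E a) = ext_in E' a.
  by rewrite ψE -[ext_in E a]addr0 -(linear0 t) φj linear0 addr0.
have ψout p : ext_out E' (ψ p) = ext_out E p.
  by rewrite ψE /φ linearD /= ext_out_in t'K add0r.
by exists ψ; split=> //; exact: ext_morphism_bijective.
Qed.

(** An equivalence carries a section to a section with the same defect. *)
Lemma equiv_realizes (E E' : rcExtension H K) (c : Z2 Γ) :
  realizes E c -> ext_equiv E E' -> realizes E' c.
Proof.
move=> [t [tK tc tΓ]] [φ [_ φin φout]].
exists (φ \o t : {linear K -> E'}); split=> [x|x y|x a] /=.
- by rewrite φout tK.
- have [tc1 tc2] := tc x y.
  by rewrite -!φin tc1 tc2 !linearB /= poisson_morphM poisson_morph_bracket.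
- by rewrite -!φin -poisson_morph_bracket tΓ.
Qed.

(** Each cocycle identity is an axiom of E evaluated on the elements t x: the
    identity for f is associativity, those for h are the Jacobi and Leibniz
    rules.  The Γ terms arise from moving t (x ⋅ y) and t [x, y] to
    t x ⋅ t y and [t x, t y] inside a bracket. *)
Lemma section_cocycle (E : rcExtension H K) (t : {linear K -> E}) :
  is_section t -> acts_by Γ t -> exists c : Z2 Γ, cocycle_of_section t c.
Proof.
move=> tK tΓ; have [r rE] := ext_coord tK.
(* r p is the H-coordinate of p, so that f and h are the defects of t *)
pose f x y := r (t x ⋅ t y); pose h x y := r ⟦t x, t y⟧.
have fE x y : ext_in E (f x y) = t x ⋅ t y - t (x ⋅ y).
  by rewrite rE poisson_morphM !tK.
have hE x y : ext_in E (h x y) = ⟦t x, t y⟧ - t ⟦x, y⟧.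
  by rewrite rE poisson_morph_bracket !tK.
have tM x y : t (x ⋅ y) = t x ⋅ t y - ext_in E (f x y).
  by rewrite fE opprB addrC subrK.
have tB x y : t ⟦x, y⟧ = ⟦t x, t y⟧ - ext_in E (h x y).
  by rewrite hE opprB addrC subrK.
have inM a p : p ⋅ ext_in E a = 0 by rewrite pmulC ext_in_pmul.
have ax : cocycle_axiom Γ f h.
  split=> [|x y||x|x y a|x y z|x y z|x y z].
  - split=> [u a v w|u a v w]; rewrite /f linearP.
      by rewrite pmulDl pmulZl linearP.
    by rewrite pmulDr pmulZr linearP.
  - by rewrite /f pmulC.
  - split=> [u a v w|u a v w]; rewrite /h linearP.
      by rewrite pbracketDl pbracketZl linearP.
    by rewrite pbracketDr pbracketZr linearP.
  - by rewrite /h pbracketxx linear0.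
  - exact: kernelM.
  - apply: (@ext_in_inj _ _ _ E).
    rewrite !fE -(pmulA x y z) (tM x y) (tM y z).
    by rewrite pmulDl pmulDr pmulNl pmulNr ext_in_pmul inM (pmulA (t x)) !subr0.
  - have hJ u v w : ext_in E (h ⟦u, v⟧ w)
        = ⟦⟦t u, t v⟧, t w⟧ + ⟦t w, ext_in E (h u v)⟧ - t ⟦⟦u, v⟧, w⟧.
      by rewrite hE tB pbracketDl pbracketNl -[- ⟦_, t w⟧]pbracketC.
    have aux (V : zmodType) (a1 b1 c1 a2 b2 c2 a3 b3 c3 : V) :
        a1 + a2 + a3 = 0 -> c1 + c2 + c3 = 0 ->
      a1 + b1 - c1 + (a2 + b2 - c2) + (a3 + b3 - c3) = b1 + b2 + b3.
      move=> a0 c0; rewrite [LHS](AC (3*3*3) ((1*4*7)*(2*5*8)*(3*6*9))) /=.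
      by rewrite -!opprD a0 c0 add0r subr0.
    apply: (@ext_in_inj _ _ _ E); rewrite !linearD /= -!tΓ !hJ.
    apply: aux; first exact: pbracket_jacobi.
    by rewrite -!linearD pbracket_jacobi linear0.
  - apply: (@ext_in_inj _ _ _ E); rewrite !linearD /= -!tΓ.
    rewrite !(fE ⟦_, _⟧, fE _ ⟦_, _⟧) hE.
    rewrite pbracket_pmul linearD /= (tM x y) !tB pbracketDl pbracketNl.
    rewrite -[- ⟦_, t z⟧]pbracketC pbracket_pmul pmulDl pmulDr pmulNl pmulNr.
    rewrite ext_in_pmul inM !subr0 opprD.
    by rewrite [LHS](AC ((2*1)*2) (3*(1*4)*(2*5))).
by exists (Cocycle (introT (is_cocycleP Γ (f, h)) ax)) => x y; split; rewrite ?fE ?hE.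
Qed.

(** If c' - c is the coboundary of g and t has defect c, then t + g has
    defect c'. *)
Lemma realizes_cohomologous (E : rcExtension H K) (c c' : Z2 Γ) :
  realizes E c -> c' - c \in @B2 F H K Γ -> realizes E c'.
Proof.
move=> [t [tK tc tΓ]] /B2P[g gP].
exists (t \+ (ext_in E \o g) : {linear K -> E}); split=> [x|x y|x a] /=.
- by rewrite linearD /= tK ext_out_in addr0.
- have [gf gh] := gP x y.
  have -> : c'.1 x y = c.1 x y - g (x ⋅ y).
    by rewrite -gf addrC subrK.
  have -> : c'.2 x y = c.2 x y + (Γ x (g y) - Γ y (g x) - g ⟦x, y⟧).
    by rewrite -gh addrC subrK.
  rewrite ![t _ + _]addrC (ext_pmulE tc) (ext_bracketE tc tΓ) !linearD !linearN /=.
  by split; rewrite [RHS]addrACA subrr addr0 // [LHS]addrC [RHS]addrAC.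
- by rewrite pbracketDl ext_in_bracket addr0 tΓ.
Qed.

(** With t and t' sections of E whose defects are c and c', the difference
    g = t' - t takes values in H, and c' - c is the coboundary of g. *)
Lemma realizes_sub (E : rcExtension H K) (c c' : Z2 Γ) :
  realizes E c -> realizes E c' -> c' - c \in @B2 F H K Γ.
Proof.
move=> [t [tK tc tΓ]] [t' [t'K t'c t'Γ]]; have [r rE] := ext_coord tK.
have t'E x : t' x = ext_in E (r (t' x)) + t x by rewrite rE t'K subrK.
(* as r vanishes on the image of t, the map r o t' is t' - t read in H *)
apply/B2P; exists (r \o t' : {linear K -> H}) => x y /=.
have [c1 c2] := t'c x y.
split; apply: (@ext_in_inj _ _ _ E).
- change (ext_in E (c'.1 x y - c.1 x y) = ext_in E (- r (t' (x ⋅ y)))).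
  rewrite linearB /= c1 (t'E x) (t'E y) (ext_pmulE tc) [in LHS](t'E (x ⋅ y)).
  by rewrite linearN /= opprD addrACA subrr addr0 [LHS]addrC addKr.
- change (ext_in E (c'.2 x y - c.2 x y) = ext_in E
    (Γ x (r (t' y)) - Γ y (r (t' x)) - r (t' ⟦x, y⟧))).
  rewrite linearB /= c2 [in LHS](t'E x) [in LHS](t'E y) (ext_bracketE tc tΓ)
    [in LHS](t'E ⟦x, y⟧).
  rewrite !linearD !linearN /= addrACA subrr addr0.
  by rewrite [LHS]addrAC addrK.
Qed.

End AbelianBase.

(** * The extension built from a cocycle *)

Section CocycleExtension.
Variables (F : fieldType) (H K : poissonType F) (Γ : {poisson K -> der H}).

(** A separate name for the vector space H * K, since the Poisson structure put
    on it depends on c. *)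
Definition crossed_product (c : Z2 Γ) : Type := (H * K)%type.

Variable c : Z2 Γ.
Local Notation P := (crossed_product c).

HB.instance Definition _ := GRing.Lmodule.on P.

Definition cpmul (p q : P) : P := (c.1 p.2 q.2, p.2 ⋅ q.2).
Definition cpbracket (p q : P) : P :=
  (Γ p.2 q.1 - Γ q.2 p.1 + c.2 p.2 q.2, ⟦p.2, q.2⟧).

Let cP : cocycle_axiom Γ c.1 c.2 := is_cocycleP Γ c (cocycle_valP c).

Let fP := cocycle_f_bilinear cP.
Let hP := cocycle_h_bilinear cP.

Lemma cocycle_h0l x : c.2 0 x = 0.
Proof.
by have := hP.1 x (-1) 0 0; rewrite /= scaler0 addr0 scaleN1r addNr.
Qed.

Lemma cocycle_h0r x : c.2 x 0 = 0.
Proof.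
by have := hP.2 x (-1) 0 0; rewrite /= scaler0 addr0 scaleN1r addNr.
Qed.

Lemma cocycle_f0l x : c.1 0 x = 0.
Proof.
by have := fP.1 x (-1) 0 0; rewrite /= scaler0 addr0 scaleN1r addNr.
Qed.

Lemma cpmul_bilinear : bilinear_for *:%R *:%R cpmul.
Proof.
split=> u a v w; congr (_, _).
- exact: fP.1.
- by rewrite /= pmulDl pmulZl.
- exact: fP.2.
- by rewrite /= pmulDr pmulZr.
Qed.

Lemma cpmulC : commutative cpmul.
Proof.
by move=> [a x] [b y]; rewrite /cpmul /= (cocycle_f_sym cP x) [x ⋅ y]pmulC.
Qed.

Lemma cpmulA : associative cpmul.
Proof.
by move=> [a x] [b y] [d z]; rewrite /cpmul /= (cocycle2 cP) pmulA.
Qed.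

Lemma cpbracket_bilinear : bilinear_for *:%R *:%R cpbracket.
Proof.
have aux (V : lmodType F) (a : F) (u1 u2 v1 v2 w1 w2 : V) :
    (a *: u1 + u2) - (a *: v1 + v2) + (a *: w1 + w2)
    = a *: (u1 - v1 + w1) + (u2 - v2 + w2).
  by rewrite opprD [X in X + _]addrACA -scalerBr addrACA -scalerDr.
split=> -[u1 u2] a [v1 v2] [w1 w2]; congr (_, _); rewrite /=.
- by rewrite kernel_linear linearP (hP.1 _ _ _ _) aux.
- by rewrite pbracketDl pbracketZl.
- by rewrite kernel_linear linearP (hP.2 _ _ _ _) aux.
- by rewrite pbracketDr pbracketZr.
Qed.

Lemma cpbracketxx p : cpbracket p p = 0.
Proof. by rewrite /cpbracket (cocycle_h_alt cP) pbracketxx subrr addr0. Qed.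

(** In the H-component the double applications of Γ cancel in pairs because
    Γ [x, y] is a commutator; what remains is the cocycle identity for h. *)
Lemma cpbracket_jacobi p q r :
  cpbracket (cpbracket p q) r + cpbracket (cpbracket q r) p
    + cpbracket (cpbracket r p) q = 0.
Proof.
case: p q r => [a x] [b y] [d z]; congr (_, _) => /=; last exact: pbracket_jacobi.
rewrite !kernel_bracket !linearD !linearN /=.
have aux (V : zmodType) (A A' B B' D D' g1 g2 g3 h1 h2 h3 : V) :
    h1 + h2 + h3 = g1 + g2 + g3 ->
    D - D' + (- B - - A - g1) + h1 + (A' - A + (- D - - B' - g2) + h2)
      + (B - B' + (- A' - - D' - g3) + h3) = 0.
  move=> hg.
  rewrite !opprK [LHS](AC ((2*3*1)*(2*3*1)*(2*3*1)) ((1*9)*(2*16)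
    *(3*13)*(4*8)*(7*15)*(10*14)*((6*12*18)*(5*11*17)))) /=.
  by rewrite !(subrr, addNr) !add0r -!opprD hg subrr.
exact/aux/(cocycle3 cP).
Qed.


Lemma cpbracket_cpmul p q r :
  cpbracket (cpmul p q) r = cpmul (cpbracket p r) q + cpmul p (cpbracket q r).
Proof.
congr (_, _); last exact: pbracket_pmul.
by rewrite /= kernelM sub0r (cocycle4 cP) addrA addKr.
Qed.

HB.instance Definition _ := Lmodule_isPoisson.Build F P
  cpmul_bilinear cpmulC cpmulA cpbracket_bilinear cpbracketxx cpbracket_jacobi
  cpbracket_cpmul.

Lemma crossed_pmulE (p q : P) : p ⋅ q = (c.1 p.2 q.2, p.2 ⋅ q.2).
Proof. by []. Qed.

Lemma crossed_bracketE (p q : P) :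
  ⟦p, q⟧ = (Γ p.2 q.1 - Γ q.2 p.1 + c.2 p.2 q.2, ⟦p.2, q.2⟧).
Proof. by []. Qed.

Lemma crossed_in_exists : abelian_poisson H ->
  exists i : {poisson H -> P}, forall a, i a = (a, 0).
Proof.
move=> abH; apply: poisson_of_fun => [k a b|a b|a b].
- by congr (_, _); rewrite /= scaler0 addr0.
- by rewrite crossed_pmulE cocycle_f0l pmul0l (abH a b).1.
- rewrite crossed_bracketE cocycle_h0l pbracket0l (abH a b).2.
  by rewrite /= !kernel0 subrr addr0.
Qed.

Lemma crossed_out_exists : exists o : {poisson P -> K}, forall p, o p = p.2.
Proof. exact: poisson_of_fun. Qed.

Lemma crossed_incl_exists : exists t : {linear K -> P}, forall x, t x = (0, x).
Proof.
by apply: linear_of_fun => k x y; congr (_, _); rewrite /= scaler0 addr0.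
Qed.

Lemma cocycle_realized : abelian_poisson H ->
  exists2 E : rcExtension H K, has_abstract_kernel Γ E & realizes E c.
Proof.
move=> abH; have [i iE] := crossed_in_exists abH.
have [o oE] := crossed_out_exists; have [t tE] := crossed_incl_exists.
have i_inj : injective i by move=> a b; rewrite !iE => -[].
have o_surj : range o = setT.
  by apply/seteqP; split=> // x _; exists (t x); rewrite // oE tE.
have exact_io : range i = (o @^-1` [set 0])%classic.
  apply/seteqP; split=> [_ [a _ <-]|[a x]] /=; first by rewrite oE iE.
  by rewrite oE /= => ->; exists a; rewrite // iE.
have central_i : (range i `<=` @ring_center F P)%classic.
  move=> _ [a _ <-] p /=.
  by rewrite iE crossed_pmulE cocycle_f0l pmul0l.
pose E := RcExtension i_inj o_surj exact_io (fun a b => (abH a b).1) central_i.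
have tK : is_section (t : {linear K -> E}) by move=> x; rewrite /= oE tE.
have tΓ : acts_by Γ (t : {linear K -> E}).
  move=> x a; rewrite /= !iE tE crossed_bracketE /= pbracket0r.
  by rewrite kernel0 cocycle_h0r subr0 addr0.
exists E; first exact: (acts_by_kernel abH tK).
exists t; split=> // x y /=; rewrite !iE !tE crossed_pmulE crossed_bracketE /=.
by split; congr (_, _); rewrite /= ?subr0 ?linear0 ?add0r ?subrr.
Qed.

End CocycleExtension.

(** * The correspondence *)

Section Correspondence.
Variables (F : fieldType) (H K : poissonType F) (abH : abelian_poisson H).
Variable Γ : {poisson K -> der H}.

Lemma kernel_realizes (E : rcExtension H K) (t : {linear K -> E}) :
    has_abstract_kernel Γ E -> is_section t ->
  exists2 c : Z2 Γ, cocycle_of_section t c & realizes E c.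
Proof.
move=> EΓ tK; have tΓ : acts_by Γ t := EΓ t tK.
by have [c tc] := section_cocycle tK tΓ; exists c => //; exists t.
Qed.

Lemma H2_eqP (c c' : Z2 Γ) :
  reflect (\pi_(H2 Γ) c = \pi_(H2 Γ) c') (c - c' \in @B2 F H K Γ).
Proof. by rewrite Quotient.idealrBE; apply: eqP. Qed.

(** The witness stored in a class is a proof, hence irrelevant. *)
Lemma RExt_ext (X Y : RExt Γ) : (forall E, ext_class_set X E <-> ext_class_set Y E) -> X = Y.
Proof.
case: X Y => [X hX] [Y hY] /= XY; have {}XY : X = Y by apply/seteqP; split=> E /XY.
by rewrite -XY in hY *; congr ExtClass.
Qed.

Lemma ext_classP (E : rcExtension H K) (EΓ : has_abstract_kernel Γ E)
    (c : Z2 Γ) :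
  realizes E c -> forall E', ext_class_set (ext_class EΓ) E' <-> realizes E' c.
Proof.
by move=> Ec E'; split; [apply: equiv_realizes | apply: realizes_equiv].
Qed.

Lemma RExt_realizes (X : RExt Γ) :
  exists c : Z2 Γ, forall E, ext_class_set X E <-> realizes E c.
Proof.
have [E EΓ XE] := ext_class_setP X; have [t tK] := ext_section_exists E.
have [c _ Ec] := kernel_realizes EΓ tK.
by exists c; rewrite XE; exact: (ext_classP EΓ Ec).
Qed.

End Correspondence.

Theorem theorem4p12 (F : fieldType) (H K : poissonType F)
    (abH : abelian_poisson H) (Γ : {poisson K -> der H}) :
  exists Φ : RExt Γ -> H2 Γ,
    bijective Φ /\
    forall (E : rcExtension H K) (EΓ : has_abstract_kernel Γ E)
           (t : {linear K -> E}),
      is_section t ->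
      exists2 c : Z2 Γ, cocycle_of_section t c
                      & Φ (ext_class EΓ) = \pi_(H2 Γ) c.
Proof.
have [γ γP] := choice (@RExt_realizes F H K abH Γ).
pose Φ X : H2 Γ := \pi_(H2 Γ) (γ X).
have ΦE X E c : ext_class_set X E -> realizes E c -> Φ X = \pi_(H2 Γ) c.
  by move=> /γP Eγ Ec; apply/H2_eqP/(realizes_sub abH Ec Eγ).
have reprP (q : H2 Γ) :
    exists X : RExt Γ, forall E, ext_class_set X E <-> realizes E (repr q).
  have [E EΓ Ec] := cocycle_realized (repr q) abH.
  by exists (ext_class EΓ); exact: (ext_classP abH EΓ Ec).
have [Ψ ΨP] := choice reprP.
exists Φ; split.
  exists Ψ => [X|q].
    apply: RExt_ext => E; rewrite ΨP γP.
    have/H2_eqP Φγ : \pi_(H2 Γ) (repr (Φ X)) = \pi_(H2 Γ) (γ X) by rewrite reprK.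
    have/H2_eqP γΦ : \pi_(H2 Γ) (γ X) = \pi_(H2 Γ) (repr (Φ X)) by rewrite reprK.
    by split=> Ec; apply: (realizes_cohomologous abH Ec).
  have [E _ Eq] := cocycle_realized (repr q) abH.
  by rewrite (ΦE _ E (repr q)) ?reprK //; apply/ΨP.
move=> E EΓ t tK; have [c tc Ec] := kernel_realizes EΓ tK.
by exists c => //; apply: (ΦE _ E c _ Ec); apply/(ext_classP abH EΓ Ec).
Qed.
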